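(* There is an absolute constant $C$ such that the following holds. For any integer $s\ge 2$ and any query points $x_1,\dots,x_m\in\mathbb{R}^2$ with $m\le s^{1/10}$, if $f\sim D_1$ and $g\sim D_2$, then the distributions of $(f(x_1),\dots,f(x_m))$ and $(g(x_1),\dots,g(x_m))$ are within total variation distance $Cs^{-1/10}$.
   Context: The distributions $D_1,D_2$ over functions $\mathbb{R}^2\to\{-1,1\}$ (depending on $s$): let $\theta\in\mathbb{R}^2$ be a uniformly random unit vector and $\theta^\perp$ its $90^\circ$ clockwise rotation. Choose $a_1,\dots,a_{s-1}$ independently uniformly from $[-1,1]$ and sort them in increasing order; set $a_0=-1$, $a_s=1$. Choose independent uniform random bits $b_1,\dots,b_s\in\{-1,1\}$, and $z$ uniform in $[-1,1]$ independent of everything else. $f\sim D_1$ is defined by $f(x)=b_i$ if $a_{i-1}<\langle x,\theta\rangle\le a_i$ for some $i\in\{1,\dots,s\}$, and $f(x)=1$ otherwise. $g\sim D_2$ is defined by $g(x)=b_i\,\mathrm{sign}(\langle x,\theta^\perp\rangle-z)$ if $a_{i-1}<\langle x,\theta\rangle\le a_i$ for some $i\in\{1,\dots,s\}$, and $g(x)=1$ otherwise. *)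

(* Defs.v *)
From HB Require Import structures.
From mathcomp Require Import all_boot all_order all_algebra.
From mathcomp Require Import all_classical all_reals all_analysis.
From mathcomp Require Import Rstruct Rstruct_topology.
From Stdlib Require Import Rdefinitions.

Set Implicit Arguments.
Unset Strict Implicit.
Unset Printing Implicit Defensive.

Import Order.TTheory GRing.Theory Num.Theory.
Local Open Scope classical_set_scope.
Local Open Scope ring_scope.

Notation R := Rdefinitions.R.

Definition pt := (R * R)%type.

Definition dot (x y : pt) : R := x.1 * y.1 + x.2 * y.2.

Definition theta_of (phi : R) : pt := (cos phi, sin phi).
Definition theta_perp (th : pt) : pt := (th.2, - th.1).

(* sign with values in {-1,1}; convention sign 0 = 1 (a null event) *)
Definition sgn (t : R) : R := if 0 <= t then 1 else -1.

Definition bitv (b : bool) : R := if b then 1 else -1.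

(* breakpoints a_0 = -1 < a_1 <= ... <= a_{s-1} < a_s = 1, where
   a_1..a_{s-1} is the increasingly sorted list of the sampled values *)
Definition breakpoints (a : seq R) : seq R :=
  -1 :: rcons (sort <=%R a) 1.

(* the piece index: Some i (i : 'I_s, standing for the paper's i+1) when
   a_i < t <= a_{i+1} *)
Definition piece (s : nat) (a : seq R) (t : R) : option 'I_s :=
  [pick i : 'I_s | (nth 0 (breakpoints a) i < t) && (t <= nth 0 (breakpoints a) i.+1)].

Definition fD1 (s : nat) (th : pt) (a : seq R) (b : {ffun 'I_s -> bool})
    (x : pt) : R :=
  if piece s a (dot x th) is Some i then bitv (b i) else 1.

Definition gD2 (s : nat) (th : pt) (a : seq R) (b : {ffun 'I_s -> bool})
    (z : R) (x : pt) : R :=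
  if piece s a (dot x th) is Some i
  then bitv (b i) * sgn (dot x (theta_perp th) - z) else 1.

(* Expectation over n independent uniform samples from [-1,1]:
   iterated (normalized) Lebesgue integrals, i.e. integration against the
   n-fold product of the uniform probability on [-1,1]. *)
Fixpoint unif_n (n : nat) (F : seq R -> \bar R) : \bar R :=
  match n with
  | 0 => F [::]
  | n'.+1 =>
    (\int[lebesgue_measure]_(y in `[(-1 : R), (1 : R)]%classic)
       ((2^-1)%:E * unif_n n' (fun l => F (y :: l))))%E
  end.

Definition unif1 (F : R -> \bar R) : \bar R :=
  (\int[lebesgue_measure]_(z in `[(-1 : R), (1 : R)]%classic) ((2^-1)%:E * F z))%E.

Definition unif_circle (F : pt -> \bar R) : \bar R :=
  (\int[lebesgue_measure]_(phi in `[(0 : R), (2 * pi : R)[%classic)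
      (((2 * pi)^-1)%:E * F (theta_of phi)))%E.

Definition unif_bits (s : nat) (F : {ffun 'I_s -> bool} -> \bar R) : \bar R :=
  (((2 ^+ s)^-1)%:E * \sum_(b : {ffun 'I_s -> bool}) F b)%E.

Definition indic (P : bool) : \bar R := (if P then 1 else 0)%E.

Definition signvec (m : nat) (v : {ffun 'I_m -> bool}) (i : 'I_m) : R :=
  bitv (v i).

Definition probD1 (s m : nat) (x : 'I_m -> pt) (v : {ffun 'I_m -> bool})
  : \bar R :=
  unif_circle (fun th => unif_n s.-1 (fun a => unif_bits (fun b : {ffun 'I_s -> bool} =>
    indic [forall i, fD1 th a b (x i) == signvec v i]))).

Definition probD2 (s m : nat) (x : 'I_m -> pt) (v : {ffun 'I_m -> bool})
  : \bar R :=
  unif_circle (fun th => unif_n s.-1 (fun a => unif_bits (fun b : {ffun 'I_s -> bool} =>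
    unif1 (fun z => indic [forall i, gD2 th a b z (x i) == signvec v i])))).

Definition tv_D1_D2 (s m : nat) (x : 'I_m -> pt) : \bar R :=
  ((2^-1)%:E * \sum_(v : {ffun 'I_m -> bool})
      `|probD1 s x v - probD2 s x v|)%E.

(* Main.v *)
Require Import Defs.
From HB Require Import structures.
From mathcomp Require Import all_boot all_order all_algebra.
From mathcomp Require Import all_classical all_reals all_analysis.
From mathcomp Require Import ring lra measurable_realfun.
From mathcomp Require Import Rstruct Rstruct_topology.

(* Fix [theta], the breakpoints and [z].  If no two query points lying in the
   same piece are separated by the line [<x, theta_perp> = z], then flipping the
   bits of the pieces seen on the negative side is a bijection exchanging the
   two models, so the answer vectors have the same law over the random bits.
   Hence the total variation distance is at most the sum, over pairs of query
   points, of the probability that the pair shares a piece and is separated.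
   Write [w] for the difference of the two points and [d] for its l1 norm.
   Separation has probability at most [min 1 d].  If [|<w, theta>| >= tau], none
   of the [s - 1] breakpoints falls between the two projections with probability
   at most [(1 - tau / 2) ^ (s - 1) = O(1 / (s tau))], and [|<w, theta>| < tau]
   has probability [O(tau / d)].  With [tau = s ^ (-1/2)] each pair contributes
   [O(s ^ (-1/2))], and there are at most [s ^ (1/5)] pairs. *)

Set Implicit Arguments.
Unset Strict Implicit.
Unset Printing Implicit Defensive.

Import Order.TTheory GRing.Theory Num.Theory.
Import numFieldNormedType.Exports.
Local Open Scope classical_set_scope.
Local Open Scope ring_scope.

(** * Iterated averages of jointly measurable functions *)

Section Avg.
Variable R : realType.
Local Notation mR := (measurableTypeR R).
Local Notation mu := (@lebesgue_measure R).

(** The factor [c] stays inside the integral and [D] is arbitrary, so that [unif1], [unif_circle]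
    and each layer of [unif_n] are instances by mere unfolding. *)
Definition avg (D : set mR) (c : R) (F : mR -> \bar R) : \bar R :=
  (\int[mu]_(y in D) (c%:E * F y))%E.

Section AvgTheory.
Variables (D : set mR) (c : R).
Hypotheses (mD : measurable D) (c0 : 0 <= c).

Lemma avg_ge0 (F : mR -> \bar R) :
  (forall y, D y -> 0 <= F y)%E -> (0 <= avg D c F)%E.
Proof. by move=> F0; apply: integral_ge0 => y Dy; rewrite mule_ge0 ?lee_fin ?F0. Qed.

(** Multiplying by the indicator of [D] in the second coordinate turns the average into a full
    marginal integral, whose measurability is part of the Fubini-Tonelli theorem. *)
Lemma measurable_avg d (T : measurableType d) (F : T -> mR -> \bar R) :
  (forall t y, 0 <= F t y)%E -> measurable_fun [set: T * mR] (fun p => F p.1 p.2) ->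
  measurable_fun [set: T] (fun t => avg D c (F t)).
Proof.
move=> F0 mF.
have -> : (fun t => avg D c (F t)) =
  fubini_F mu (fun p : T * mR => (c%:E * F p.1 p.2) * (\1_D p.2)%:E)%E.
  apply/funext => t; rewrite /avg /fubini_F [LHS]integral_mkcond; apply: eq_integral => y _.
  by rewrite patchE indicE/=; case: ifPn => Dy; rewrite ?mule1 ?mule0.
apply: measurable_fun_fubini_tonelli_F.
  apply: emeasurable_funM; first exact: emeasurable_funM.
  apply/measurable_EFinP; apply: measurableT_comp => //.
by move=> [t y] /=; rewrite !mule_ge0 ?lee_fin ?F0.
Qed.

Lemma avgD (F G : mR -> \bar R) :
  (forall y, 0 <= F y)%E -> (forall y, 0 <= G y)%E ->
  measurable_fun setT F -> measurable_fun setT G ->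
  avg D c (fun y => F y + G y)%E = (avg D c F + avg D c G)%E.
Proof.
move=> F0 G0 mF mG; rewrite /avg -ge0_integralD //.
- by apply: eq_integral => y _; rewrite ge0_muleDr.
- by move=> y _; rewrite mule_ge0 ?lee_fin.
- by apply: emeasurable_funM => //; apply: measurable_funTS.
- by move=> y _; rewrite mule_ge0 ?lee_fin.
- by apply: emeasurable_funM => //; apply: measurable_funTS.
Qed.

Lemma avgZ (k : R) (F : mR -> \bar R) : 0 <= k -> (forall y, 0 <= F y)%E ->
  measurable_fun setT F -> avg D c (fun y => k%:E * F y)%E = (k%:E * avg D c F)%E.
Proof.
move=> k0 F0 mF; rewrite /avg -ge0_integralZl //.
- by apply: eq_integral => y _; rewrite muleCA.
- by apply: emeasurable_funM => //; apply: measurable_funTS.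
- by move=> y _; rewrite mule_ge0 ?lee_fin.
Qed.

Lemma le_avg (F G : mR -> \bar R) : (forall y, D y -> 0 <= F y)%E ->
  measurable_fun setT F -> measurable_fun setT G ->
  (forall y, D y -> F y <= G y)%E -> (avg D c F <= avg D c G)%E.
Proof.
move=> F0 mF mG FG; apply: ge0_le_integral => //.
- by move=> y Dy; rewrite mule_ge0 ?lee_fin ?F0.
- by apply: emeasurable_funM => //; apply: measurable_funTS.
- by apply: emeasurable_funM => //; apply: measurable_funTS.
- by move=> y Dy; rewrite lee_wpmul2l ?lee_fin ?FG.
Qed.

Lemma eq_avg (F G : mR -> \bar R) : (forall y, D y -> F y = G y) -> avg D c F = avg D c G.
Proof. by move=> FG; apply: eq_integral => y /set_mem Dy; rewrite FG. Qed.

Lemma avg_cst (k : R) : avg D c (fun=> k%:E) = ((c * k)%:E * mu D)%E.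
Proof. by rewrite /avg integral_cst. Qed.

Lemma avg_sum I (s : seq I) (F : I -> mR -> \bar R) :
  (forall i y, 0 <= F i y)%E -> (forall i, measurable_fun setT (F i)) ->
  avg D c (fun y => \sum_(i <- s) F i y)%E = (\sum_(i <- s) avg D c (F i))%E.
Proof.
move=> F0 mF; rewrite /avg -ge0_integral_sum //.
- apply: eq_integral => y _; rewrite ge0_sume_distrr //.
- by move=> i; apply: emeasurable_funM => //; apply: measurable_funTS.
- by move=> i y _; rewrite mule_ge0 ?lee_fin.
Qed.

End AvgTheory.

(* Measurability of [(t, l) |-> F t l] on [T * R^n], where [R^n] is the set of
   sequences of length [n]. *)
Fixpoint jmeas d' (U : measurableType d') n d (T : measurableType d)
    (F : T -> seq R -> U) {struct n} : Prop :=
  match n with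
  | 0 => measurable_fun setT (fun t => F t [::])
  | n'.+1 => jmeas n' (fun (p : T * mR) l => F p.1 (p.2 :: l))
  end.

Section JMeas.
Context d1 d2 d3 (U : measurableType d1) (V : measurableType d2) (W : measurableType d3).

Lemma jmeas_eq n d (T : measurableType d) (F G : T -> seq R -> U) :
  (forall t l, size l = n -> F t l = G t l) -> jmeas n F -> jmeas n G.
Proof.
elim: n d T F G => [|n IH] d T F G FG /=.
  by congr measurable_fun; apply/funext => t; exact: FG.
by apply: IH => -[t y] l /= sl; apply: FG => /=; rewrite sl.
Qed.

Lemma jmeas_comp n d (T : measurableType d) (g : U -> V) (F : T -> seq R -> U) :
  measurable_fun setT g -> jmeas n F -> jmeas n (fun t l => g (F t l)).
Proof.
move=> mg; elim: n d T F => [|n IH] d T F /=; last exact: IH.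
exact: measurableT_comp.
Qed.

(** The condition on [g] ranges over all parameter spaces because the space gains a real factor at
    each step of the induction. In this form the closure lemmas for sums, products and conjunctions
    of measurable functions apply directly. *)
Lemma jmeas_comp2 n d (T : measurableType d) (g : U -> V -> W)
    (F : T -> seq R -> U) (G : T -> seq R -> V) :
  (forall d' (T' : measurableType d') (f : T' -> U) (f' : T' -> V),
     measurable_fun setT f -> measurable_fun setT f' ->
     measurable_fun setT (fun t => g (f t) (f' t))) ->
  jmeas n F -> jmeas n G -> jmeas n (fun t l => g (F t l) (G t l)).
Proof.
move=> mg; elim: n d T F G => [|n IH] d T F G /=; last exact: IH.
exact: mg.
Qed.

Lemma jmeas_cst n d (T : measurableType d) (f : T -> U) :
  measurable_fun setT f -> jmeas n (fun t _ => f t).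
Proof.
elim: n d T f => [|n IH] d T f mf //=.
by apply: (IH _ _ (f \o fst)); apply: measurableT_comp.
Qed.

Lemma jmeas_precomp n d (T : measurableType d) d' (T' : measurableType d')
    (h : T' -> T) (F : T -> seq R -> U) :
  measurable_fun setT h -> jmeas n F -> jmeas n (fun t l => F (h t) l).
Proof.
elim: n d T d' T' h F => [|n IH] d T d' T' h F mh /=.
  by move=> mF; apply: measurableT_comp mF mh.
move=> mF; apply: (IH _ _ _ _ (fun p : T' * mR => (h p.1, p.2)) _ _ mF).
by apply: measurable_fun_pair => //; apply: measurableT_comp.
Qed.

Lemma jmeas_section n d (T : measurableType d) (F : T -> seq R -> U) l :
  size l = n -> jmeas n F -> measurable_fun setT (fun t => F t l).
Proof.
elim: n d T F l => [|n IH] d T F [|y l] //= [sl] mF.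
exact: (measurable_fun_pair1 (f := fun p : T * mR => F p.1 ((p.2 : R) :: l)) y (IH _ _ _ l sl mF)).
Qed.

End JMeas.

Lemma jmeas_sum n d (T : measurableType d) I (s : seq I) (F : I -> T -> seq R -> R) :
  (forall i, jmeas n (F i)) -> jmeas n (fun t l => \sum_(i <- s) F i t l : R).
Proof.
move=> mF; elim: s => [|i s IH].
  apply: (@jmeas_eq _ _ _ _ _ (fun _ _ => 0 : R)).
    by move=> t l _; rewrite big_nil.
  exact: jmeas_cst.
apply: (@jmeas_eq _ _ _ _ _ (fun t l => F i t l + \sum_(j <- s) F j t l : R)).
  by move=> t l _; rewrite big_cons.
apply: (jmeas_comp2 _ (mF i) IH) => *; exact: measurable_funD.
Qed.

Lemma jmeas_all n d (T : measurableType d) I (s : seq I) (F : I -> T -> seq R -> bool) :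
  (forall i, jmeas n (F i)) -> jmeas n (fun t l => all (fun i => F i t l) s).
Proof.
move=> mF; elim: s => [|i s IH] /=; first exact: jmeas_cst.
apply: (jmeas_comp2 _ (mF i) IH) => *; exact: measurable_and.
Qed.

Lemma jmeas_count n d (T : measurableType d) (h : T -> R) :
  measurable_fun setT h -> jmeas n (fun t l => count (fun y : R => y < h t) l).
Proof.
elim: n d T h => [|n IH] d T h mh /=; first exact: measurable_cst.
have m1 : jmeas n (fun (p : T * mR) _ => nat_of_bool ((p.2 : R) < h p.1)).
  apply: jmeas_cst; apply: (@measurableT_comp _ _ _ _ _ _ nat_of_bool) => //.
  apply: measurable_fun_ltr => //; exact: measurableT_comp.
have m2 : jmeas n (fun (p : T * mR) l => count (fun y : R => y < h p.1) l).
  by apply: (IH _ _ (h \o fst)); apply: measurableT_comp.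
by apply: (jmeas_comp2 _ m1 m2) => *; exact: measurable_fun_addn.
Qed.

Lemma jmeas_prod n d (T : measurableType d) (g : mR -> R) :
  measurable_fun setT g -> jmeas n (fun (t : T) l => \prod_(y <- l) g y : R).
Proof.
move=> mg; elim: n d T => [|n IH] d T /=; first by under eq_fun do rewrite big_nil; exact: measurable_cst.
apply: (@jmeas_eq _ _ _ _ _ (fun (p : T * mR) l => g p.2 * \prod_(y <- l) g y)).
  by move=> t l _; rewrite big_cons.
apply: (jmeas_comp2 _ _ (IH _ _)) => [*|]; first exact: measurable_funM.
by apply: (@jmeas_cst _ _ _ _ _ (fun p : T * mR => g p.2)); apply: measurableT_comp.
Qed.

Lemma jmeas_avg n d (T : measurableType d) (D : set mR) c (F : T -> mR -> seq R -> \bar R) :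
  measurable D -> 0 <= c -> (forall t y l, 0 <= F t y l)%E ->
  jmeas n (fun (p : T * mR) l => F p.1 p.2 l) ->
  jmeas n (fun t l => avg D c (fun y => F t y l)).
Proof.
move=> mD c0; elim: n d T F => [|n IH] d T F F0 /=; first exact: measurable_avg.
move=> mF; apply: (IH _ _ (fun (p : T * mR) (y : mR) l => F p.1 y ((p.2 : R) :: l))) => //.
(* The first entry of the sequence and the averaged variable trade places: [((t, l0), y)] is sent to
   [((t, y), l0)]. *)
apply: (@jmeas_precomp _ _ n _ _ _ _ (fun q : T * mR * mR => ((q.1.1, q.2), q.1.2)) _ _ mF).
by repeat apply: measurable_fun_pair => //; apply: measurableT_comp.
Qed.

(** * Averages over the cube of sampled breakpoints *)

Fixpoint avgn (n : nat) (F : seq R -> \bar R) : \bar R :=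
  match n with
  | 0 => F [::]
  | n'.+1 => avg `[-1, 1]%classic 2^-1 (fun y => avgn n' (fun l => F (y :: l)))
  end.

(** The sequences that the iterated average actually visits; integrands need to be compared only
    there. *)
Definition inbox n : set (seq R) :=
  [set l | size l = n /\ forall y, y \in l -> -1 <= y <= 1].

Lemma inbox_cons n y l : `[-1, 1]%classic y -> inbox n l -> inbox n.+1 (y :: l).
Proof.
rewrite /= in_itv /= => Hy [sl Hl]; split => /=; first by rewrite sl.
by move=> z; rewrite inE => /orP[/eqP->|/Hl].
Qed.

Lemma avgn_ge0 n F : (forall l, inbox n l -> 0 <= F l)%E -> (0 <= avgn n F)%E.
Proof.
elim: n F => [|n IH] F F0 /=; first by apply: F0.
by apply: avg_ge0 => // y Hy; apply: IH => l Hl; apply: F0; exact: inbox_cons.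
Qed.

Lemma eq_avgn n F G : (forall l, inbox n l -> F l = G l) -> avgn n F = avgn n G.
Proof.
elim: n F G => [|n IH] F G FG /=; first by apply: FG.
by apply: eq_avg => y Hy; apply: IH => l Hl; apply: FG; exact: inbox_cons.
Qed.

Lemma measurable_avgn n d (T : measurableType d) (F : T -> seq R -> \bar R) :
  (forall t l, 0 <= F t l)%E -> jmeas n F ->
  measurable_fun [set: T] (fun t => avgn n (F t)).
Proof.
elim: n d T F => [|n IH] d T F F0 //= mF.
apply: (measurable_avg _ _ (F := fun t y => avgn n (fun l => F t (y :: l)))) => //.
- by move=> t y; apply: avgn_ge0.
- apply: (IH _ _ (fun (p : T * mR) l => F p.1 ((p.2 : R) :: l))) => //.
Qed.

Lemma measurable_avgn_section n d (T : measurableType d) (F : T -> seq R -> \bar R) t :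
  (forall t l, 0 <= F t l)%E -> jmeas n.+1 F ->
  measurable_fun [set: mR] (fun y => avgn n (fun l => F t (y :: l))).
Proof.
move=> F0 /= mF.
have := measurable_avgn (F := fun (p : T * mR) l => F p.1 ((p.2 : R) :: l)) _ mF.
move=> /(_ (fun _ _ => F0 _ _)) /measurable_fun_pair2 => /(_ t); exact.
Qed.

(** The parameter [t] makes the induction possible: the entry [y] sampled first is absorbed into the
    parameter [(t, y)], where joint measurability is available. *)
Lemma avgnD n d (T : measurableType d) (F G : T -> seq R -> \bar R) t :
  (forall t l, 0 <= F t l)%E -> (forall t l, 0 <= G t l)%E -> jmeas n F -> jmeas n G ->
  avgn n (fun l => F t l + G t l)%E = (avgn n (F t) + avgn n (G t))%E.
Proof.
elim: n d T F G t => [|n IH] d T F G t F0 G0 mF mG //=.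
rewrite -avgD //; first last.
- exact: measurable_avgn_section.
- exact: measurable_avgn_section.
- by move=> y; apply: avgn_ge0.
- by move=> y; apply: avgn_ge0.
by apply: eq_avg => y _; exact: (IH _ _ _ _ (t, y) _ _ mF mG).
Qed.

Lemma avgnZ n d (T : measurableType d) k (F : T -> seq R -> \bar R) t : 0 <= k ->
  (forall t l, 0 <= F t l)%E -> jmeas n F ->
  avgn n (fun l => k%:E * F t l)%E = (k%:E * avgn n (F t))%E.
Proof.
move=> k0; elim: n d T F t => [|n IH] d T F t F0 mF //=.
rewrite -avgZ //; first last.
- exact: measurable_avgn_section.
- by move=> y; apply: avgn_ge0.
by apply: eq_avg => y _; exact: (IH _ _ _ (t, y) _ mF).
Qed.

Lemma le_avgn n d (T : measurableType d) (F G : T -> seq R -> \bar R) t :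
  (forall t l, 0 <= F t l)%E -> (forall t l, 0 <= G t l)%E -> jmeas n F -> jmeas n G ->
  (forall l, inbox n l -> F t l <= G t l)%E -> (avgn n (F t) <= avgn n (G t))%E.
Proof.
elim: n d T F G t => [|n IH] d T F G t F0 G0 mF mG FG /=; first exact: FG.
apply: le_avg => //.
- by move=> y _; apply: avgn_ge0.
- exact: measurable_avgn_section.
- exact: measurable_avgn_section.
move=> y Hy; apply: (IH _ _ _ _ (t, y) _ _ mF mG) => // l Hl /=.
by apply: FG; exact: inbox_cons.
Qed.

(** Independence of the samples. The factor [k] is general because it collects the values of [g] at
    the entries already sampled. *)
Lemma avgn_prod n (g : mR -> R) k r : 0 <= k -> 0 <= r -> (forall y, 0 <= g y) ->
  measurable_fun setT g -> avg (`[-1, 1]%classic : set R) 2^-1 (fun y => (g y)%:E) = r%:E ->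
  avgn n (fun l => (k * \prod_(y <- l) g y)%:E) = (k * r ^+ n)%:E.
Proof.
move=> k0 r0 g0 mg gr; elim: n k k0 => [|n IH] k k0 /=; first by rewrite big_nil.
transitivity (avg (`[-1, 1]%classic : set R) 2^-1 (fun y => (k * r ^+ n)%:E * (g y)%:E)%E).
  apply: eq_avg => y _; rewrite -EFinM mulrAC -IH ?mulr_ge0 //.
  by apply: eq_avgn => l _; rewrite big_cons mulrA.
rewrite avgZ // ?gr -?EFinM ?exprSr ?mulrA //.
- by rewrite mulr_ge0 ?exprn_ge0.
- exact/measurable_EFinP.
Qed.

Lemma avg_box_cst (k : R) : avg (`[-1, 1]%classic : set R) 2^-1 (fun=> k%:E) = k%:E.
Proof.
have lt11 : (-1 : R) < 1 by lra.
rewrite avg_cst // lebesgue_measure_itv /= lte_fin lt11 -EFinD -EFinM; congr EFin.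
by field.
Qed.

Lemma avgn_cst n (k : R) : avgn n (fun=> k%:E) = k%:E.
Proof.
elim: n => [//|n IH] /=.
by under eq_avg do rewrite IH; rewrite avg_box_cst.
Qed.

Lemma avgn_sum n d (T : measurableType d) I (s : seq I) (F : I -> T -> seq R -> \bar R) t :
  (forall i t l, 0 <= F i t l)%E -> (forall i, jmeas n (F i)) ->
  avgn n (fun l => \sum_(i <- s) F i t l)%E = (\sum_(i <- s) avgn n (F i t))%E.
Proof.
move=> F0; elim: n d T F t F0 => [|n IH] d T F t F0 mF //=.
rewrite -avg_sum //.
- by apply: eq_avg => y _; exact: (IH _ _ (fun i (p : T * mR) l => F i p.1 ((p.2 : R) :: l)) (t, y)).
- by move=> i y; apply: avgn_ge0.
- by move=> i; apply: measurable_avgn_section.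
Qed.

End Avg.

(** * Coupling through the random bits *)

Section Coupling.
Variables (n m : nat).

(* The bit seen by a query point in piece number [k] (with [k = 0] standing for
   "outside (-1, 1]"), when the second factor of [gD2] is [bitv s]. *)
Definition outcome (b : {ffun 'I_n.+1 -> bool}) (k : nat) (s : bool) : bool :=
  if k is k'.+1 then b (inord k') (+) ~~ s else true.

Definition hits (K : 'I_m -> nat) (S : 'I_m -> bool) (v : {ffun 'I_m -> bool})
    (b : {ffun 'I_n.+1 -> bool}) : bool :=
  [forall i, outcome b (K i) (S i) == v i].

(** Index 0 is excluded: outside the strip both models answer 1, so two such points can never betray
    a sign change. *)
Definition same (k l : nat) : bool := (k == l) && (0 < k)%N.

Lemma sum_hits_separated K S v : (forall i, K i <= n.+1)%N ->
  (forall i j, same (K i) (K j) -> S i = S j) ->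
  (\sum_b hits K S v b = \sum_b hits K (fun=> true) v b)%N.
Proof.
move=> Kn KS.
(* A piece is flipped when the query points in it lie on the negative side. By [KS] all of them
   agree, so whichever one [pick] returns is representative; a piece without query points is left
   alone. *)
pose flip (k : 'I_n.+1) := if [pick i | K i == k.+1] is Some i then ~~ S i else false.
pose h (b : {ffun 'I_n.+1 -> bool}) := [ffun k => b k (+) flip k].
have hK : involutive h by move=> b; apply/ffunP => k; rewrite !ffunE addbK.
rewrite [RHS](reindex_inj (inv_inj hK)); apply: eq_bigr => b _; congr nat_of_bool.
apply: eq_forallb => i; congr (_ == _); rewrite /outcome.
case Ei: (K i) => [//|k]; rewrite ffunE addbF /flip.
have kn : (k < n.+1)%N by rewrite -Ei Kn.
case: pickP => [j /eqP|/(_ i)]; rewrite inordK // ?Ei ?eqxx //.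
by move=> Ej; rewrite (KS i j) // /same Ei Ej eqxx.
Qed.

(** Each bit vector [b] produces exactly one answer vector [v], so the double sum counts the bit
    vectors. *)
Lemma sum_hits K S : (\sum_v \sum_b hits K S v b = 2 ^ n.+1)%N.
Proof.
rewrite exchange_big /= -[in RHS](card_ord n.+1) -card_bool -card_ffun -sum1_card.
apply: eq_bigr => b _.
rewrite (bigD1 [ffun i => outcome b (K i) (S i)]) //= big1 ?addn0.
  by rewrite /hits; case: forallP => // -[] i; rewrite ffunE.
move=> v /eqP vb; rewrite /hits; case: forallP => // H; case: vb.
by apply/ffunP => i; rewrite ffunE; apply/esym/eqP.
Qed.

(** There are two cases. If no pair shares a piece and is separated, the two laws coincide and the
    left side is 0. Otherwise the right side is at least 2, which bounds the l1 distance of any two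
    probability laws. *)
Lemma sum_diff_hits (R : realFieldType) K S : (forall i, K i <= n.+1)%N ->
  \sum_v `| (2 ^+ n.+1)^-1 * (\sum_b hits K (fun=> true) v b)%N%:R
          - (2 ^+ n.+1)^-1 * (\sum_b hits K S v b)%N%:R | <=
  2 * \sum_(p : 'I_m * 'I_m) (same (K p.1) (K p.2) && (S p.1 != S p.2))%:R :> R.
Proof.
move=> Kn.
have [/forallP Hall|/forallPn [i /forallPn[j]]] :=
  boolP [forall i, forall j, same (K i) (K j) ==> (S i == S j)].
  rewrite big1; first by rewrite mulr_ge0 // sumr_ge0.
  move=> v _; rewrite (@sum_hits_separated K S) ?subrr ?normr0 //.
  by move=> i j ij; have /forallP/(_ j)/implyP/(_ ij)/eqP := Hall i.
rewrite negb_imply => Hij.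
apply: (@le_trans _ _ 2).
  apply: (@le_trans _ _ (\sum_v (2 ^+ n.+1)^-1 * ((\sum_b hits K (fun=> true) v b)%N%:R
          + (\sum_b hits K S v b)%N%:R))).
    apply: ler_sum => v _; rewrite mulrDr; apply: le_trans (ler_normB _ _) _.
    by rewrite !ger0_norm ?mulr_ge0 ?invr_ge0 ?exprn_ge0.
  rewrite -mulr_sumr big_split /= -!natr_sum !sum_hits natrX mulrDr.
  by rewrite !mulVf ?expf_neq0 ?pnatr_eq0.
by rewrite -[leLHS]mulr1 ler_pM2l // (bigD1 (i, j)) //= Hij lerDl sumr_ge0.
Qed.

End Coupling.

(** * Pieces described by counting breakpoints *)

(** Counting the samples below [t] makes sorting unnecessary, and measurability in the samples
    becomes that of a finite count. Pieces are numbered from 1, and 0 means outside (-1, 1]. *)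
Definition piece_index (R : realDomainType) (a : seq R) (t : R) : nat :=
  if (-1 < t) && (t <= 1) then (count (fun y => y < t) a).+1 else 0.

Lemma piece_index_le (R : realDomainType) n (a : seq R) t : size a = n -> (piece_index a t <= n.+1)%N.
Proof. by rewrite /piece_index => <-; case: ifP => // _; rewrite ltnS count_size. Qed.

(** In the sorted list, entry [k] is below [t] exactly when [k] is less than the count [c], so the
    two inequalities defining a piece force its index to be [c]. For [t] outside (-1, 1], the
    samples lying in [-1, 1] force [c] to be 0 or [n], and then no index qualifies. *)
Lemma pieceE n (a : seq R) t : size a = n -> (forall y, y \in a -> -1 <= y <= 1) ->
  piece n.+1 a t = if piece_index a t is k.+1 then Some (inord k) else None.
Proof.
move=> sa Ha; rewrite /piece /piece_index.
set c := count _ a.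
have cn : (c <= n)%N by rewrite -sa count_size.
have ss : sorted <=%R (sort <=%R a) by apply: sort_sorted; exact: le_total.
have sz : size (sort <=%R a) = n by rewrite size_sort.
have cE : count (< t)%O (sort <=%R a) = c by rewrite count_sort.
have nthlt k : (k < n)%N -> (nth 0 (sort <=%R a) k < t) = (k < c)%N.
  move=> kn; case: (ltnP k c) => kc.
    by apply: (nth_count_lt _ ss); rewrite cE.
  apply/negbTE; rewrite -leNgt; apply: (nth_count_ge _ ss).
  by rewrite cE kc sz.
have left (i : 'I_n.+1) : (nth 0 (breakpoints a) i < t) =
    if i == 0 :> nat then -1 < t else (i <= c)%N.
  rewrite /breakpoints; case: i => -[|i] //= ilt.
  have iltn : (i < n)%N := ilt.
  by rewrite nth_rcons sz iltn nthlt.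
have right (i : 'I_n.+1) : (t <= nth 0 (breakpoints a) i.+1) =
    if i == n :> nat then t <= 1 else (c <= i)%N.
  rewrite /breakpoints /= nth_rcons sz.
  have [->|iN] := eqVneq (i : nat) n; first by rewrite ltnn.
  have ilt : (i < n)%N by rewrite ltn_neqAle iN -ltnS ltn_ord.
  by rewrite ilt leNgt nthlt // -leqNgt.
case: ifPn => [/andP[t1 t2]|tout].
  case: pickP => [i|/(_ (inord c))]; rewrite left right.
    rewrite t1 t2 => /andP[H1 H2]; congr Some; apply: val_inj; rewrite /= inordK ?ltnS //.
    apply/eqP; rewrite eqn_leq; apply/andP; split.
      by move: H1; case: eqP => // ->.
    by move: H2; case: eqP => // ->.
  by rewrite inordK ?ltnS // t1 t2 leqnn; do 2 case: ifP.
case: pickP => // i; rewrite left right.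
move: tout; rewrite negb_and -leNgt -ltNge => /orP[t1|t1].
  have c0 : c = 0%N.
    apply/eqP; rewrite -leqn0 leqNgt -has_count; apply/hasPn => y /Ha /andP[y1 _].
    by rewrite -leNgt (le_trans t1).
  by rewrite c0 ltNge t1 /= leqn0; case: (altP eqP).
have ca : c = n.
  rewrite -sa; apply/eqP; rewrite -all_count; apply/allP => y /Ha /andP[_ y1].
  exact: le_lt_trans t1.
rewrite leNgt t1 ca andbC; case: (altP eqP) => //= iN.
by rewrite leqNgt ltn_neqAle iN -ltnS ltn_ord.
Qed.

Lemma same_piece_index (R : realDomainType) (a : seq R) t u : same (piece_index a t) (piece_index a u) ->
  [/\ -1 < t <= 1, -1 < u <= 1 &
     forall y, y \in a -> (y < t) = (y < u)].
Proof.
rewrite /same /piece_index; case: ifP => // Ht; case: ifP => // Hu /andP[/eqP[E] _].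
split=> //.
wlog tu : t u Ht Hu E / t <= u => [H|].
  by case: (leP t u) => [/H|/ltW/H H' y ya]; [exact|rewrite -H'].
move=> y ya; apply/idP/idP => [|yu]; first by move/lt_le_trans; exact.
apply/negPn/negP => yt; move: E; apply/eqP; rewrite ltn_eqF //.
(* With [t <= y < u], the list is split at [y]: that entry is counted for [u] but not for [t], and
   the remaining entries count at least as much for [u], so the counts differ. *)
rewrite -(cat_take_drop (index y a) a) !count_cat.
rewrite (drop_nth y) ?index_mem // nth_index //= yu (negbTE yt) /= add0n.
have le s : (count (fun y => y < t)%R s <= count (fun y => y < u)%R s)%N.
  by apply: sub_count => z /= /lt_le_trans; exact.
by rewrite addnA addn1 addSn ltnS leq_add // le.
Qed.

(** * Directions almost orthogonal to a given vector *)

Section Strip.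
Variable R : realType.
Local Notation mR := (measurableTypeR R).
Local Notation mu := (@lebesgue_measure R).
Implicit Types (w : R * R) (phi tau : R).

Definition dotc w phi : R := w.1 * cos phi + w.2 * sin phi.

Lemma measurable_dotc w : measurable_fun [set: mR] (dotc w).
Proof.
apply: measurable_funD; apply: measurable_funM => //; apply: continuous_measurable_fun.
- exact: continuous_cos.
- exact: continuous_sin.
Qed.

Lemma norm_dotc_le w phi : `|dotc w phi| <= `|w.1| + `|w.2|.
Proof.
apply: le_trans (ler_normD _ _) _; rewrite !normrM.
by apply: lerD; rewrite ler_piMr ?cos_max ?sin_max.
Qed.

(** By the mean value theorem [sin x = cos c * x] for some [c] between 0 and [x], and cosine
    decreases on [0, 1]. *)
Lemma sin_ge_cos1 (x : R) : 0 <= x <= 1 -> cos 1 * x <= sin x.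
Proof.
move=> /andP[x0 x1].
have [|c] := @MVT_segment R sin cos 0 x x0 (fun y _ => is_derive_sin y).
  by apply/continuous_subspaceT => ?; exact: continuous_sin.
rewrite in_itv /= sin0 !subr0 => /andP[c0 cx] ->.
apply: ler_wpM2r => //.
have pi2 := pi_ge2 R.
case: (ltrgtP c 1) => [c1|c1|->//]; last by have := lt_le_trans c1 cx; rewrite ltNge x1.
by apply/ltW; rewrite ltr_cos // in_itv /=; apply/andP; split; lra.
Qed.

(* [w.1 * sin (psi - phi)] and [w.2 * sin (psi - phi)] are combinations of the
   two projections with coefficients bounded by 1. *)
Lemma strip_diam w phi psi tau : `|psi - phi| <= 1 ->
  `|dotc w phi| < tau -> `|dotc w psi| < tau ->
  (`|w.1| + `|w.2|) * cos 1 * `|psi - phi| <= 4 * tau.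
Proof.
move=> d1 h1 h2.
have s1 : cos 1 * `|psi - phi| <= `|sin (psi - phi)|.
  have := @sin_ge_cos1 `|psi - phi|; rewrite normr_ge0 d1 => /(_ isT) /le_trans; apply.
  have [h|h] := leP 0 (psi - phi); first by rewrite (ger0_norm h) ler_norm.
  by rewrite (ltr0_norm h) sinN -normrN ler_norm.
rewrite -mulrA; apply: (@le_trans _ _ ((`|w.1| + `|w.2|) * `|sin (psi - phi)|)).
  by rewrite ler_wpM2l ?addr_ge0.
rewrite mulrDl -!normrM.
have comb (a b x y : R) : `|a| <= 1 -> `|b| <= 1 -> `|x| < tau -> `|y| < tau ->
    `|a * x - b * y| <= 2 * tau.
  move=> a1 b1 xt yt; apply: le_trans (ler_normB _ _) _; rewrite !normrM.
  rewrite (_ : 2 * tau = tau + tau); last by ring.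
  apply: lerD; [apply: le_trans _ (ltW xt)|apply: le_trans _ (ltW yt)];
    by rewrite ler_piMl.
have -> : w.1 * sin (psi - phi) = sin psi * dotc w phi - sin phi * dotc w psi.
  by rewrite sinB /dotc; ring.
have -> : w.2 * sin (psi - phi) = cos phi * dotc w psi - cos psi * dotc w phi.
  by rewrite sinB /dotc; ring.
rewrite (_ : 4 * tau = 2 * tau + 2 * tau); last by ring.
by apply: lerD; apply: comb; rewrite ?cos_max ?sin_max.
Qed.

Lemma avg_indic_le (D A : set mR) c : measurable D -> measurable A -> 0 <= c ->
  (avg D c (fun y => (\1_A y)%:E) <= c%:E * mu A)%E.
Proof.
move=> mD mA c0; rewrite /avg ge0_integralZl //; last first.
  by apply/measurable_EFinP; exact: measurable_indic.
rewrite integral_indic // lee_wpmul2l ?lee_fin //.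
by apply: le_measure; rewrite ?inE //; apply: measurableI.
Qed.

Lemma mu_itvcc (a b : R) : a <= b -> mu `[a, b] = (b - a)%:E.
Proof.
rewrite lebesgue_measure_itv /= lte_fin le_eqVlt => /orP[/eqP->|->]; last by rewrite EFinB.
by rewrite ltxx subrr.
Qed.

Definition circle : set mR := `[0, 2 * pi[%classic.

Lemma measurable_circle : measurable circle.
Proof. by rewrite /circle. Qed.
Hint Resolve measurable_circle : core.

Lemma avg_circle_cst (k : R) : avg circle (2 * pi)^-1 (fun=> k%:E) = k%:E.
Proof.
have pi0 := pi_gt0 R.
rewrite /circle avg_cst // lebesgue_measure_itv /= lte_fin mulr_gt0 // oppr0 adde0 -EFinM.
congr EFin; move: (pi : R) pi0 => p p0.
by field; rewrite gt_eqF.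
Qed.

(** Cut the circle into 8 arcs of length at most 1. By [strip_diam] the favourable angles of one arc
    lie within [D] of any one of them, hence in an interval of length [2 * D]. Eight such intervals
    have total length [64 * tau / (d * cos 1)], and the normalization [(2 * pi)^-1] is bounded by
    1. *)
Lemma avg_strip w tau : 0 < tau -> 0 < `|w.1| + `|w.2| ->
  (avg circle (2 * pi)^-1 (fun phi => (`|dotc w phi| < tau)%R%:R%:E)
    <= (64 / cos 1 * tau / (`|w.1| + `|w.2|))%:E)%E.
Proof.
set d := _ + _ => tau0 d0.
have c0 := cos1_gt0 R.
pose D := 4 * tau / (d * cos 1).
have D0 : 0 <= D by rewrite divr_ge0 ?mulr_ge0 // ltW // mulr_gt0.
have pi2 := pi_ge2 R.
have c20 : 0 <= (2 * pi)^-1 :> R by rewrite invr_ge0; lra.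
(* The centre [p k] is some favourable angle of the [k]-th arc; if there is none, the default 0
   serves vacuously. *)
have /choice[p Hp] : forall k : nat, exists r : R, forall phi, k%:R <= phi < k%:R + 1 ->
    `|dotc w phi| < tau -> `|phi - r| <= D.
  move=> k.
  have [[r [rk rt]]|H] := pselect (exists r, k%:R <= r < k%:R + 1 /\ `|dotc w r| < tau).
    exists r => phi phik phit; rewrite /D ler_pdivlMr ?mulr_gt0 // mulrC.
    apply: strip_diam => //.
    by rewrite ler_norml; apply/andP; split; move: rk phik => /andP[? ?] /andP[? ?]; lra.
  by exists 0 => phi phik phit; case: H; exists phi.
pose J k : set mR := `[p k - D, p k + D]%classic.
have mJ k : measurable (J k) by rewrite /J.
have mJ1 k : measurable_fun setT (fun phi : mR => (\1_(J k) phi : R)%:E).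
  by apply/measurable_EFinP; apply: measurable_indic.
apply: (@le_trans _ _ (avg circle (2 * pi)^-1 (fun phi => \sum_(0 <= k < 8) (\1_(J k) phi)%:E)%E)).
  apply: le_avg => //.
  - apply/measurable_EFinP; apply: (@measurableT_comp _ _ _ _ _ _ (fun b : bool => b%:R : R)) => //.
    apply: measurable_fun_ltr => //; apply: measurableT_comp => //; exact: measurable_dotc.
  - by apply: emeasurable_sum => k; exact: mJ1.
  move=> phi; rewrite /circle /= in_itv /= => /andP[phi0 phi1].
  rewrite sumEFin lee_fin.
  case: (boolP (`|dotc w phi| < tau)) => pt; last by rewrite sumr_ge0.
  (* The integer part of [phi] names its arc, and [2 * pi < 8]. *)
  have k8 : (Num.truncn phi < 8)%N.
    rewrite truncn_lt_nat // (lt_le_trans phi1) //.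
    by have := pihalf_lt2 R; lra.
  have := truncn_itv phi0; rewrite -natr1 => /Hp /(_ pt) Hk.
  rewrite big_mkord (bigD1 (Ordinal k8)) //= indicE mem_set ?lerDl ?sumr_ge0 //.
  by rewrite /J /= in_itv /= -ler_distl.
rewrite avg_sum //.
apply: (@le_trans _ _ (\sum_(0 <= k < 8) (2 * D)%:E)%E).
  apply: lee_sum => k _; apply: le_trans (avg_indic_le _ _ _) _ => //.
  rewrite mu_itvcc; last lra.
  rewrite -EFinM lee_fin (_ : p k + D - (p k - D) = 2 * D); last by ring.
  apply: ler_piMl; first by rewrite mulr_ge0.
  by rewrite invf_le1; lra.
rewrite sumEFin lee_fin sumr_const_nat subn0 /D -mulr_natl.
rewrite le_eqVlt; apply/orP; left; apply/eqP; field.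
by rewrite !gt_eqF.
Qed.

End Strip.

(** * Probability that two points share a piece or are separated *)

Section Estimates.
Variable R : realType.
Local Notation mR := (measurableTypeR R).
Local Notation mu := (@lebesgue_measure R).
Local Notation box := (`[-1, 1]%classic : set R).

Lemma measurable_boolr d (T : measurableType d) (f : T -> bool) :
  measurable_fun setT f -> measurable_fun setT (fun t => (f t)%:R : R).
Proof. by move=> mf; apply: (@measurableT_comp _ _ _ _ _ _ (fun b : bool => b%:R : R)). Qed.

Lemma jmeas_piece_index n d (T : measurableType d) (h : T -> R) :
  measurable_fun setT h -> jmeas n (fun t l => piece_index l (h t)).
Proof.
move=> mh.
have m1 : jmeas (R := R) n (fun t _ => (-1 < h t) && (h t <= 1)).
  apply: jmeas_cst; apply: measurable_and.
    exact: measurable_fun_ltr.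
  exact: measurable_fun_ler.
have m2 := jmeas_count n mh.
apply: (jmeas_comp2 (g := fun (b : bool) k => if b then k.+1 else 0%N) _ m1 m2).
move=> d' T' f f' mf mf'; apply: measurable_fun_ifT => //.
exact: measurableT_comp.
Qed.

Lemma jmeas_hits n m k d (T : measurableType d) (h : 'I_m -> T -> R) (S : 'I_m -> T -> bool)
    v (b : {ffun 'I_k.+1 -> bool}) :
  (forall i, measurable_fun setT (h i)) -> (forall i, measurable_fun setT (S i)) ->
  jmeas n (fun t l => hits (fun i => piece_index l (h i t)) (fun i => S i t) v b).
Proof.
move=> mh mS.
(* Branching on the side leaves, in each branch, a function of the natural number [piece_index]
   alone, and every such function is measurable. *)
apply: (@jmeas_eq _ _ _ _ _ _ (fun t l => all (fun i =>
   if S i t then outcome b (piece_index l (h i t)) true == v i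
   else outcome b (piece_index l (h i t)) false == v i) (enum 'I_m))).
  move=> t l _; rewrite /hits; apply/allP/forallP => H i.
    by have := H i; rewrite mem_enum => /(_ isT); case: (S i t).
  by move=> _; have := H i; case: (S i t).
apply: jmeas_all => i.
apply: (jmeas_comp2 (g := fun (s : bool) k => if s then outcome b k true == v i
   else outcome b k false == v i) _ (jmeas_cst _ n (mS i)) (jmeas_piece_index n (mh i))).
move=> d' T' f f' mf mf'; apply: measurable_fun_ifT => //.
  exact: (@measurableT_comp _ _ _ _ _ _ (fun k => outcome b k true == v i)).
exact: (@measurableT_comp _ _ _ _ _ _ (fun k => outcome b k false == v i)).
Qed.

Lemma jmeas_same n d (T : measurableType d) (h g : T -> R) :
  measurable_fun setT h -> measurable_fun setT g ->
  jmeas n (fun t l => same (piece_index l (h t)) (piece_index l (g t))).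
Proof.
move=> mh mg.
apply: (jmeas_comp2 _ (jmeas_piece_index n mh) (jmeas_piece_index n mg)) => d' T' f f' mf mf'.
apply: measurable_and; first exact: measurable_fun_eqn.
exact: (@measurableT_comp _ _ _ _ _ _ (fun k => 0 < k)%N).
Qed.

Lemma jmeas_natr n d (T : measurableType d) (F : T -> seq R -> bool) :
  jmeas n F -> jmeas n (fun t l => (F t l)%:R : R).
Proof. by apply: (jmeas_comp (g := fun b : bool => b%:R : R)). Qed.

Lemma jmeas_EFin n d (T : measurableType d) (F : T -> seq R -> R) :
  jmeas n F -> jmeas n (fun t l => (F t l)%:E).
Proof. by apply: (jmeas_comp (g := @EFin R)). Qed.

(** The left side does not increase with [n], since [(1 - x) * (1 + (n + 1) * x) = 1 + n * x - (n +
    1) * x ^ 2]. *)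
Lemma bernoulli (x : R) n : 0 <= x <= 1 -> (1 - x) ^+ n * (1 + n%:R * x) <= 1.
Proof.
move=> /andP[x0 x1]; elim: n => [|n IH]; first by rewrite expr0; lra.
apply: le_trans _ IH; rewrite exprSr -mulrA ler_wpM2l ?exprn_ge0 ?subr_ge0 //.
rewrite -natr1 -subr_ge0 (_ : _ - _ = (n%:R + 1) * (x * x)); last by ring.
by rewrite mulr_ge0 ?addr_ge0 ?mulr_ge0.
Qed.

Lemma avg_avoid (t u : R) : -1 < t -> t <= u -> u <= 1 ->
  avg box 2^-1 (fun y => (1 - \1_(`[t, u[%classic : set R) y)%:E) = (1 - (u - t) / 2)%:E.
Proof.
move=> t1 tu u1; set J := `[t, u[%classic : set R.
have mJ : measurable J by rewrite /J.
have mI : measurable_fun setT (fun y : mR => (\1_J y : R)) by apply: measurable_indic.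
have aJ : avg box 2^-1 (fun y => (\1_J y)%:E) = ((u - t) / 2)%:E.
  rewrite /avg ge0_integralZl //; last by apply/measurable_EFinP; apply: measurable_funTS.
  rewrite integral_indic // (_ : J `&` box = J).
    rewrite /= /J lebesgue_measure_itv /= lte_fin; move: tu; rewrite le_eqVlt => /orP[/eqP->|->].
      by rewrite ltxx mule0 subrr mul0r.
    by rewrite -EFinB -EFinM mulrC.
  apply/seteqP; split => y; first by case.
  by move=> Jy; split => //; move: Jy; rewrite /J /= !in_itv /= => /andP[? ?]; apply/andP; split; lra.
(* The averages of the indicator and of its complement add up to 1, which avoids integrating a
   difference. *)
have := avg_box_cst (1 : R).
rewrite (_ : (fun=> 1%:E) = (fun y : mR => (1 - \1_J y)%:E + (\1_J y)%:E)%E); last first.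
  by apply/funext => y; rewrite -EFinD subrK.
rewrite avgD //.
- rewrite aJ; case: (avg _ _ _) => [r| |] //= [] H; congr EFin.
  by lra.
- by apply/measurable_EFinP; apply: measurable_funB.
- exact/measurable_EFinP.
Qed.

(** When [|t - u| >= tau], sharing a piece forces all [n] samples to miss the interval between [t]
    and [u]. With [x = |t - u| / 2] this has probability [(1 - x) ^ n], at most [(1 + n * x)^-1] by
    [bernoulli], and [2 * x >= tau]. *)
Lemma avgn_same n (t u tau : R) : (0 < n)%N -> 0 < tau ->
  (avgn n (fun l => (same (piece_index l t) (piece_index l u))%:R%:E)
    <= ((`|t - u| < tau)%R%:R + 2 / (n%:R * tau))%:E)%E.
Proof.
move=> n0 tau0.
have n0' : 0 < n%:R :> R by rewrite ltr0n.
have e0 : 0 <= 2 / (n%:R * tau) by rewrite divr_ge0 // mulr_ge0 // ltW.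
wlog tu : t u / t <= u => [H|].
  case: (leP t u) => [/H //|/ltW/H]; rewrite distrC; apply: le_trans.
  rewrite le_eqVlt (eq_avgn (G := fun l => (same (piece_index l u) (piece_index l t))%:R%:E)) ?eqxx //.
  by move=> l _; rewrite /same; case: eqVneq => [->|].
(* A dummy parameter: monotonicity of [avgn] is stated for parametrized families. *)
pose z0 : mR := (0 : R).
pose F (_ : mR) l : \bar R := (same (piece_index l t) (piece_index l u))%:R%:E.
have F0 z l : (0 <= F z l)%E by rewrite lee_fin.
have mF : jmeas n F.
  by apply: jmeas_EFin; apply: jmeas_natr; apply: jmeas_same.
have le_F (G : mR -> seq R -> \bar R) : (forall z l, 0 <= G z l)%E -> jmeas n G ->
    (forall l, inbox n l -> F z0 l <= G z0 l)%E -> (avgn n (F z0) <= avgn n (G z0))%E.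
  by move=> G0 mG; apply: le_avgn.
rewrite -/(F z0).
case: (ltP `|t - u| tau) => [_|tut].
  apply: (@le_trans _ _ 1%:E); last by rewrite lee_fin lerDl.
  rewrite -(avgn_cst n 1); apply: (le_F (fun _ _ => 1%:E)) => //.
    by apply: jmeas_cst.
  by move=> l _; rewrite lee_fin; case: (same _ _).
rewrite add0r.
have [/andP[t1 u1]|tu1] := boolP ((-1 < t) && (u <= 1)); last first.
  apply: (@le_trans _ _ 0%:E); last by rewrite lee_fin.
  rewrite -(avgn_cst n 0); apply: (le_F (fun _ _ => 0%:E)) => //.
    by apply: jmeas_cst.
  move=> l _; rewrite lee_fin; case: (boolP (same _ _)) => // /same_piece_index[] /andP[? ?] /andP[? ?] _.
  by case/andP: tu1.
pose g (y : mR) : R := 1 - \1_(`[t, u[%classic : set R) y.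
have g0 y : 0 <= g y by rewrite subr_ge0 indicE; case: (_ \in _).
have mg : measurable_fun setT g by apply: measurable_funB => //; apply: measurable_indic.
pose x := (u - t) / 2.
have x01 : 0 <= x <= 1 by rewrite /x; apply/andP; split; lra.
apply: (@le_trans _ _ ((1 * (1 - x) ^+ n)%:E)).
  rewrite -(@avgn_prod _ n g) //; last 2 first.
    by case/andP: x01 => ? ?; lra.
    exact: avg_avoid.
  apply: (le_F (fun _ l => (1 * \prod_(y <- l) g y)%:E)).
  - by move=> _ l; rewrite lee_fin mul1r prodr_ge0.
  - apply: jmeas_EFin; apply: (@jmeas_eq _ _ _ _ _ _ (fun _ l => \prod_(y <- l) g y)).
      by move=> *; rewrite mul1r.
    exact: jmeas_prod.
  - move=> l _; rewrite lee_fin mul1r; case: (boolP (same _ _)) => [|_]; last exact: prodr_ge0.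
    move=> /same_piece_index[_ _ H].
    rewrite big_seq big1 // => y /H yl; rewrite /g indicE memNset ?subr0 //= in_itv /=.
    by move=> /andP[ty yu]; move: yl; rewrite yu ltNge ty.
rewrite lee_fin mul1r.
have Dx : 0 < 1 + n%:R * x by rewrite ltr_pwDl // mulr_ge0 ?(ltW n0') //; case/andP: x01.
apply: (@le_trans _ _ (1 + n%:R * x)^-1).
  by rewrite -[leRHS]mul1r ler_pdivlMr // bernoulli.
rewrite -[2 / _]invrK invf_div lef_pV2 ?posrE //; last by rewrite divr_gt0 ?mulr_gt0.
have : tau <= 2 * x by move: tut; rewrite distrC ger0_norm /x; lra.
by move=> tx; have := ler_wpM2l (ltW n0') tx; lra.
Qed.

(** A separating [z] lies between [p] and [q], an interval of length [|p - q|]; the density 1/2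
    leaves a factor 2 to spare. The other bound holds for any probability. *)
Lemma avg_sep (p q : R) :
  (avg box 2^-1 (fun z => ((0 <= p - z) != (0 <= q - z))%R%:R%:E)
    <= (Num.min 1 `|p - q|)%:E)%E.
Proof.
have m1 : measurable_fun setT (fun z : mR => (((0 <= p - z) != (0 <= q - z))%R%:R : R)%:E).
  apply/measurable_EFinP; apply: measurable_boolr.
  rewrite (_ : (fun _ => _) = fun z : mR => ((z <= p) != (z <= q))%R); last first.
    by apply/funext => z; rewrite !subr_ge0.
  rewrite (_ : (fun _ => _) = fun z : mR => if (z <= p)%R then ~~ (z <= q)%R else (z <= q)%R).
    apply: measurable_fun_ifT; [|apply: measurable_neg|]; apply: measurable_fun_ler => //.
  by apply/funext => z; case: (z <= p)%R; case: (z <= q)%R.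
rewrite EFin_min le_min; apply/andP; split.
  rewrite -(avg_box_cst 1); apply: le_avg => //.
  by move=> z _; rewrite lee_fin; case: (_ != _).
wlog pq : p q m1 / p <= q => [H|].
  case: (leP p q) => [/H //|/ltW qp]; first exact.
  rewrite distrC; apply: le_trans (H _ _ _ qp).
    by rewrite le_eqVlt; apply/orP; left; apply/eqP; apply: eq_avg => z _; rewrite eq_sym.
  by under eq_fun do rewrite eq_sym.
apply: (@le_trans _ _ (avg box 2^-1 (fun z => (\1_(`[p, q]%classic : set R) z)%:E))).
  apply: le_avg => //.
    by apply/measurable_EFinP; apply: measurable_indic.
  move=> z _; rewrite lee_fin indicE !subr_ge0; case: (boolP (_ \in _)) => zpq.
    by case: (_ != _).
  case: (leP z p) => zp; first by rewrite (le_trans zp pq).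
  case: (leP z q) => // zq; move: zpq; rewrite mem_set //= in_itv /= zq andbT; exact: ltW.
apply: le_trans (avg_indic_le _ _ _) _ => //.
rewrite mu_itvcc // -EFinM lee_fin distrC ger0_norm ?subr_ge0 //.
by rewrite -subr_ge0 in pq; lra.
Qed.

End Estimates.

(** * Expectation over the direction and the breakpoints *)

Section Expectation.
Variable R : realType.
Local Notation mR := (measurableTypeR R).
Local Notation box := (`[-1, 1]%classic : set R).

Definition expect n (F : mR -> seq R -> \bar R) : \bar R :=
  avg (@circle R) (2 * pi)^-1 (fun phi => avgn n (F phi)).

Definition admissible n (F : mR -> seq R -> \bar R) : Prop :=
  (forall t l, 0 <= F t l)%E /\ jmeas n F.

Let c0 : 0 <= (2 * pi)^-1 :> R.
Proof. by rewrite invr_ge0 mulr_ge0 ?pi_ge0. Qed.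

Let mEx n F : admissible n F -> measurable_fun setT (fun phi => avgn n (F phi)).
Proof. by move=> [F0 mF]; exact: measurable_avgn. Qed.

Let Ex0 n F phi : admissible n F -> (0 <= avgn n (F phi))%E.
Proof. by move=> [F0 mF]; exact: avgn_ge0. Qed.

Lemma expect_ge0 n F : admissible n F -> (0 <= expect n F)%E.
Proof. by move=> aF; apply: avg_ge0 => // y _; exact: Ex0. Qed.

Lemma le_expect n F G : admissible n F -> admissible n G ->
  (forall phi l, inbox n l -> F phi l <= G phi l)%E -> (expect n F <= expect n G)%E.
Proof.
move=> aF aG FG; apply: le_avg => //; [exact: measurable_circle|by move=> y _; exact: Ex0|exact: mEx|exact: mEx|].
by move=> phi _; case: aF aG => [? ?] [? ?]; apply: le_avgn => // l; exact: FG.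
Qed.

Lemma expectD n F G : admissible n F -> admissible n G ->
  expect n (fun phi l => F phi l + G phi l)%E = (expect n F + expect n G)%E.
Proof.
move=> aF aG; rewrite /expect -avgD //.
- by apply: eq_avg => phi _; case: aF aG => [? ?] [? ?]; apply: avgnD.
- exact: measurable_circle.
- by move=> y; exact: Ex0.
- by move=> y; exact: Ex0.
- exact: mEx.
- exact: mEx.
Qed.

Lemma expectZ n k F : 0 <= k -> admissible n F ->
  expect n (fun phi l => k%:E * F phi l)%E = (k%:E * expect n F)%E.
Proof.
move=> k0 aF; rewrite /expect -avgZ //.
- by apply: eq_avg => phi _; case: aF => [? ?]; apply: avgnZ.
- exact: measurable_circle.
- by move=> y; exact: Ex0.
- exact: mEx.
Qed.

Lemma expect_sum n I (s : seq I) (F : I -> mR -> seq R -> \bar R) :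
  (forall i, admissible n (F i)) ->
  expect n (fun phi l => \sum_(i <- s) F i phi l)%E = (\sum_(i <- s) expect n (F i))%E.
Proof.
move=> aF; rewrite /expect -avg_sum //.
- apply: eq_avg => phi _; apply: (@avgn_sum _ n _ mR).
    by move=> i; case: (aF i).
  by move=> i; case: (aF i).
- exact: measurable_circle.
- by move=> i y; exact: Ex0.
- by move=> i; exact: mEx.
Qed.

Lemma expect_cst n k : expect n (fun _ _ => k%:E) = k%:E.
Proof. by rewrite /expect; under eq_avg do rewrite avgn_cst; rewrite avg_circle_cst. Qed.

Lemma admissible_fin n (F : mR -> seq R -> R) :
  (forall t l, 0 <= F t l) -> jmeas n F -> admissible n (fun t l => (F t l)%:E).
Proof. by move=> F0 mF; split; [move=> t l; rewrite lee_fin|exact: jmeas_EFin]. Qed.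

Lemma admissibleD n F G : admissible n F -> admissible n G ->
  admissible n (fun phi l => F phi l + G phi l)%E.
Proof.
move=> [F1 F2] [G1 G2]; split; first by move=> t l; rewrite adde_ge0.
by apply: (jmeas_comp2 _ F2 G2) => *; exact: emeasurable_funD.
Qed.

Lemma admissible_sum n I (s : seq I) (F : I -> mR -> seq R -> \bar R) :
  (forall i, admissible n (F i)) -> admissible n (fun phi l => \sum_(i <- s) F i phi l)%E.
Proof.
move=> aF; split; first by move=> t l; apply: sume_ge0 => i _; case: (aF i).
elim: s => [|i s IH].
  apply: (@jmeas_eq _ _ _ _ _ _ (fun _ _ => 0%E)); first by move=> *; rewrite big_nil.
  exact: jmeas_cst.
apply: (@jmeas_eq _ _ _ _ _ _ (fun phi l => F i phi l + \sum_(j <- s) F j phi l)%E).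
  by move=> *; rewrite big_cons.
by apply: (jmeas_comp2 _ (proj2 (aF i)) IH) => *; exact: emeasurable_funD.
Qed.

Lemma admissibleZ n k F : 0 <= k -> admissible n F -> admissible n (fun phi l => k%:E * F phi l)%E.
Proof.
move=> k0 [F1 F2]; split; first by move=> t l; rewrite mule_ge0.
by apply: (jmeas_comp _ F2); exact: measurable_funeM.
Qed.

(** The pointwise bound on the difference is split into two additive inequalities, because
    additivity is available for nonnegative functions only. Finiteness of both expectations gives
    the subtraction a meaning; that of [D] may be infinite. *)
Lemma expect_dist n F G D : admissible n F -> admissible n G -> admissible n D ->
  (expect n F < +oo)%E -> (expect n G < +oo)%E ->
  (forall phi l, inbox n l -> F phi l <= G phi l + D phi l)%E ->
  (forall phi l, inbox n l -> G phi l <= F phi l + D phi l)%E ->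
  (`|expect n F - expect n G| <= expect n D)%E.
Proof.
move=> aF aG aD Foo Goo FG GF.
have fF : expect n F \is a fin_num by rewrite ge0_fin_numE // expect_ge0.
have fG : expect n G \is a fin_num by rewrite ge0_fin_numE // expect_ge0.
have H1 : (expect n F <= expect n G + expect n D)%E.
  by rewrite -expectD //; apply: le_expect => //; exact: admissibleD.
have H2 : (expect n G <= expect n F + expect n D)%E.
  by rewrite -expectD //; apply: le_expect => //; exact: admissibleD.
move: H1 H2; rewrite -(fineK fF) -(fineK fG).
have := expect_ge0 aD; case: (expect n D) => [r| |] //= _.
  rewrite -!EFinD !lee_fin => H1 H2; rewrite ler_norml; apply/andP; split; lra.
by move=> _ _; rewrite leey.
Qed.

End Expectation.

(** * Comparison of the two laws of answers *)

Section Main.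
Variable R : realType.
Local Notation mR := (measurableTypeR R).
Local Notation box := (`[-1, 1]%classic : set R).
Variables (n m : nat) (x : 'I_m -> R * R).

(* [dotc (perp w) phi] is [dot w (theta_perp (theta_of phi))]. *)
Definition perp (w : R * R) : R * R := (- w.2, w.1).

(** The conditional probability of the answer vector [v], given the pieces and the sides of the
    query points. *)
Definition freq (K : 'I_m -> nat) (S : 'I_m -> bool) v : R :=
  (2 ^+ n.+1)^-1 * (\sum_(b : {ffun 'I_n.+1 -> bool}) hits K S v b)%N%:R.

Lemma freq_ge0 K S v : 0 <= freq K S v.
Proof. by rewrite mulr_ge0 ?invr_ge0 ?exprn_ge0. Qed.

Lemma freq_le1 K S v : freq K S v <= 1.
Proof.
rewrite /freq mulrC ler_pdivrMr ?exprn_gt0 // mul1r -natrX ler_nat -(sum_hits n K S).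
by rewrite [leqRHS](bigD1 v) //= leq_addr.
Qed.

Definition pieces (phi : mR) (l : seq R) (i : 'I_m) : nat := piece_index l (dotc (x i) phi).
Definition side (phi z : mR) (i : 'I_m) : bool := 0 <= dotc (perp (x i)) phi - z.

Definition freq1 v phi l : R := freq (pieces phi l) (fun=> true) v.
Definition freq2 v phi z l : R := freq (pieces phi l) (side phi z) v.

Lemma measurable_side i : measurable_fun setT (fun p : mR * mR => side p.1 p.2 i).
Proof.
apply: measurable_fun_ler => //; apply: measurable_funB => //.
by apply: measurableT_comp => //; exact: measurable_dotc.
Qed.

Lemma jmeas_freq d (T : measurableType d) (h : 'I_m -> T -> R) (S : 'I_m -> T -> bool) v :
  (forall i, measurable_fun setT (h i)) -> (forall i, measurable_fun setT (S i)) ->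
  jmeas n (fun t l => freq (fun i => piece_index l (h i t)) (fun i => S i t) v).
Proof.
move=> mh mS; apply: (jmeas_comp (g := fun r : R => (2 ^+ n.+1)^-1 * r)).
  exact: measurable_funM.
apply: (@jmeas_eq _ _ _ _ _ _ (fun t l => \sum_(b : {ffun 'I_n.+1 -> bool})
   (hits (fun i => piece_index l (h i t)) (fun i => S i t) v b)%:R : R)).
  by move=> t l _; rewrite natr_sum.
by apply: jmeas_sum => b; apply: jmeas_natr; apply: jmeas_hits.
Qed.

Lemma jmeas_freq1 v : jmeas n (freq1 v).
Proof. by apply: jmeas_freq => i //; exact: measurable_dotc. Qed.

Lemma jmeas_freq2 v : jmeas n (fun p : mR * mR => freq2 v p.1 p.2).
Proof.
apply: (@jmeas_freq _ _ (fun i (p : mR * mR) => dotc (x i) p.1)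
  (fun i (p : mR * mR) => side p.1 p.2 i)) => i.
  by apply: measurableT_comp => //; exact: measurable_dotc.
exact: measurable_side.
Qed.

Lemma jmeas_freq1_fst v : jmeas n (fun p : mR * mR => freq1 v p.1).
Proof. exact: (jmeas_precomp (h := fst) _ (jmeas_freq1 v)). Qed.

Definition mean2 v phi l : \bar R := avg box 2^-1 (fun z => (freq2 v phi z l)%:E).

Definition gap v phi l : \bar R :=
  avg box 2^-1 (fun z => `|freq1 v phi l - freq2 v phi z l|%:E).

Lemma admissible_freq1 v : admissible n (fun phi l => (freq1 v phi l)%:E).
Proof. by apply: admissible_fin; [move=> *; exact: freq_ge0|exact: jmeas_freq1]. Qed.

Lemma admissible_mean2 v : admissible n (mean2 v).
Proof.
split; first by move=> phi l; apply: avg_ge0 => // z _; rewrite lee_fin freq_ge0.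
apply: (@jmeas_avg _ _ _ _ _ _ (fun phi z l => (freq2 v phi z l)%:E)) => //.
  by move=> *; rewrite lee_fin freq_ge0.
by apply: jmeas_EFin; exact: jmeas_freq2.
Qed.

Lemma jmeas_dist v :
  jmeas n (fun (p : mR * mR) l => `|freq1 v p.1 l - freq2 v p.1 p.2 l| : R).
Proof.
apply: (jmeas_comp2 (g := fun a b : R => `|a - b| : R) _ (jmeas_freq1_fst v) (jmeas_freq2 v)).
by move=> *; apply: measurableT_comp => //; exact: measurable_funB.
Qed.

Lemma admissible_gap v : admissible n (gap v).
Proof.
split; first by move=> phi l; apply: avg_ge0 => // z _; rewrite lee_fin.
apply: (@jmeas_avg _ _ _ _ _ _ (fun phi z l => `|freq1 v phi l - freq2 v phi z l|%:E)) => //.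
by apply: jmeas_EFin; exact: jmeas_dist.
Qed.

Lemma measurable_freq2_z v phi l : size l = n ->
  measurable_fun setT (fun z : mR => freq2 v phi z l).
Proof.
move=> sl; apply: (measurable_fun_pair2 (f := fun p : mR * mR => freq2 v p.1 p.2 l) phi).
exact: (jmeas_section sl (jmeas_freq2 v)).
Qed.

(** Exchanges the averages over [z] and over the bits: [probD2] takes [z] innermost, whereas the
    coupling needs the bits innermost. *)
Lemma mean2E v phi l : size l = n ->
  mean2 v phi l = (((2 ^+ n.+1)^-1)%:E * \sum_(b : {ffun 'I_n.+1 -> bool})
    avg box 2^-1 (fun z => (hits (pieces phi l) (side phi z) v b)%:R%:E))%E.
Proof.
move=> sl.
have mh (b : {ffun 'I_n.+1 -> bool}) :
    measurable_fun setT (fun z : mR => ((hits (pieces phi l) (side phi z) v b)%:R : R)%:E).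
  apply/measurable_EFinP; apply: measurable_boolr.
  apply: (measurable_fun_pair2
    (f := fun p : mR * mR => hits (pieces p.1 l) (side p.1 p.2) v b) phi).
  apply: (jmeas_section sl (F := fun (p : mR * mR) l => hits (pieces p.1 l) (side p.1 p.2) v b)).
  apply: (jmeas_hits n (h := fun i (p : mR * mR) => dotc (x i) p.1)
    (S := fun i (p : mR * mR) => side p.1 p.2 i)) => i; last exact: measurable_side.
  by apply: measurableT_comp => //; exact: measurable_dotc.
rewrite -avg_sum // -avgZ //.
- by apply: eq_avg => z _; rewrite sumEFin -EFinM /freq2 /freq natr_sum.
- by move=> z; apply: sume_ge0.
- exact: emeasurable_sum.
Qed.

Lemma measurable_dist_z v phi l : size l = n ->
  measurable_fun setT (fun z : mR => `|freq1 v phi l - freq2 v phi z l|).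
Proof.
move=> sl; apply: measurableT_comp => //; apply: measurable_funB => //.
exact: measurable_freq2_z.
Qed.

Lemma freq1_le_mean2 v phi l : size l = n ->
  ((freq1 v phi l)%:E <= mean2 v phi l + gap v phi l)%E.
Proof.
move=> sl; have m1 := measurable_freq2_z v phi sl; have m2 := measurable_dist_z v phi sl.
rewrite -avg_box_cst /mean2 /gap -avgD //; last 3 first.
- by move=> z; rewrite lee_fin freq_ge0.
- exact/measurable_EFinP.
- exact/measurable_EFinP.
apply: le_avg => //.
- by move=> z _; rewrite lee_fin freq_ge0.
- by apply/measurable_EFinP; exact: measurable_funD.
- by move=> z _; rewrite lee_fin -lerBlDl ler_norm.
Qed.

Lemma mean2_le_freq1 v phi l : size l = n ->
  (mean2 v phi l <= (freq1 v phi l)%:E + gap v phi l)%E.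
Proof.
move=> sl; have m1 := measurable_freq2_z v phi sl; have m2 := measurable_dist_z v phi sl.
rewrite -[(freq1 _ _ _)%:E]avg_box_cst /mean2 /gap -avgD //; last 2 first.
- by move=> z; rewrite lee_fin freq_ge0.
- exact/measurable_EFinP.
apply: le_avg => //.
- by move=> z _; rewrite lee_fin freq_ge0.
- exact/measurable_EFinP.
- by apply/measurable_EFinP; exact: measurable_funD.
- by move=> z _; rewrite lee_fin -lerBlDl distrC ler_norm.
Qed.

Definition dist1 (p : 'I_m * 'I_m) : R :=
  `|(x p.1).1 - (x p.2).1| + `|(x p.1).2 - (x p.2).2|.

Definition collide (p : 'I_m * 'I_m) phi l : bool := same (pieces phi l p.1) (pieces phi l p.2).

Lemma dist1_ge0 p : 0 <= dist1 p. Proof. by rewrite addr_ge0. Qed.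

(** For each [z], [sum_diff_hits] bounds the sum by separated pairs sharing a piece. Sharing a piece
    does not depend on [z], so averaging over [z] affects only the separation, which [avg_sep]
    bounds. *)
Lemma sum_gap_le phi l : inbox n l ->
  (\sum_v gap v phi l <=
   \sum_(p : 'I_m * 'I_m) (2 * Num.min 1 (dist1 p))%:E * (collide p phi l)%:R%:E)%E.
Proof.
move=> [sl lbox].
rewrite -avg_sum //; last by move=> v; apply/measurable_EFinP; exact: measurable_dist_z.
pose sep (p : 'I_m * 'I_m) (z : mR) : bool := side phi z p.1 != side phi z p.2.
have msep p : measurable_fun setT (fun z : mR => ((sep p z)%:R : R)%:E).
  apply/measurable_EFinP; apply: measurable_boolr.
  have ms i : measurable_fun setT (fun z : mR => side phi z i).
    exact: (measurable_fun_pair2 (f := fun p : mR * mR => side p.1 p.2 i) phi (measurable_side i)).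
  rewrite (_ : sep p = fun z : mR => if side phi z p.1 then ~~ side phi z p.2 else side phi z p.2).
    by apply: measurable_fun_ifT => //; apply: measurable_neg.
  by apply/funext => z; rewrite /sep; case: (side _ _ _); case: (side _ _ _).
apply: (@le_trans _ _ (avg box 2^-1 (fun z =>
    \sum_(p : 'I_m * 'I_m) (2 * (collide p phi l)%:R)%:E * (sep p z)%:R%:E)%E)).
  apply: le_avg => //.
  - by move=> z _; apply: sume_ge0.
  - by apply: emeasurable_sum => v; apply/measurable_EFinP; exact: measurable_dist_z.
  - by apply: emeasurable_sum => p; apply: measurable_funeM.
  move=> z _; rewrite sumEFin.
  under [leRHS]eq_bigr do rewrite -EFinM.
  rewrite sumEFin lee_fin.
  apply: le_trans (sum_diff_hits _ _ _) _.
    by move=> i; exact: piece_index_le.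
  rewrite mulr_sumr ler_sum // => p _.
  by rewrite -mulnb natrM mulrA.
rewrite avg_sum //; last by move=> p; apply: measurable_funeM.
apply: lee_sum => p _; rewrite avgZ //.
apply: le_trans (lee_wpmul2l _ (avg_sep _ _)) _; first by rewrite lee_fin.
rewrite -!EFinM lee_fin -!mulrA ler_pM2l // mulrC ler_wpM2r // le_min !ge_min lexx /=.
set d := `|_ - _|; suff -> : d <= dist1 p by rewrite orbT.
(* The difference of the perpendicular projections is the projection of the rotated difference
   vector, whose l1 norm is again [dist1 p]. *)
have -> : d = `|dotc (- ((x p.1).2 - (x p.2).2), (x p.1).1 - (x p.2).1) phi|.
  by rewrite /d /dotc /=; congr `|_|; ring.
by apply: le_trans (norm_dotc_le _ _) _; rewrite /= normrN addrC.
Qed.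

(** The separation factor pays for close pairs: [Num.min 1 d] is at most [d], which cancels the
    [1 / d] of the strip estimate, and at most 1, which keeps the other term. *)
Lemma expect_collide p tau : (0 < n)%N -> 0 < tau -> 
  ((Num.min 1 (dist1 p))%:E * expect n (fun phi l => (collide p phi l)%:R%:E)
   <= (64 / cos 1 * tau + 2 / (n%:R * tau))%:E)%E.
Proof.
move=> n0 tau0.
have c0 := cos1_gt0 R.
have e0 : 0 <= 2 / (n%:R * tau) by rewrite divr_ge0 // mulr_ge0 // ltW.
have c20 : 0 <= (2 * pi)^-1 :> R by rewrite invr_ge0 mulr_ge0 ?pi_ge0.
have K0 : 0 <= 64 / cos 1 * tau by rewrite mulr_ge0 ?divr_ge0 // ltW.
(* Coinciding points are never separated; they are set aside because the strip estimate divides by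
   their distance. *)
have [d0|dN0] := eqVneq (dist1 p) 0.
  by rewrite d0 min_r // mul0e lee_fin addr_ge0.
have d0 : 0 < dist1 p by rewrite lt_neqAle eq_sym dN0 dist1_ge0.
pose w : R * R := ((x p.1).1 - (x p.2).1, (x p.1).2 - (x p.2).2).
have mstrip : measurable_fun setT (fun phi : mR => ((`|dotc w phi| < tau)%R%:R : R)).
  apply: measurable_boolr; apply: measurable_fun_ltr => //; apply: measurableT_comp => //.
  exact: measurable_dotc.
have E1 : (expect n (fun phi l => (collide p phi l)%:R%:E)
    <= (64 / cos 1 * tau / dist1 p + 2 / (n%:R * tau))%:E)%E.
  apply: (@le_trans _ _ (avg (@circle R) (2 * pi)^-1
     (fun phi => (`|dotc w phi| < tau)%R%:R%:E + (2 / (n%:R * tau))%:E)%E)).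
    apply: le_avg => //.
    - exact: measurable_circle.
    - by move=> phi _; apply: avgn_ge0 => l _; rewrite lee_fin.
    - apply: (@measurable_avgn _ n _ mR (fun phi l => (collide p phi l)%:R%:E)) => //.
      apply: jmeas_EFin; apply: jmeas_natr; apply: jmeas_same; exact: measurable_dotc.
    - by apply: emeasurable_funD => //; exact/measurable_EFinP.
    move=> phi _; apply: le_trans (avgn_same _ _ n0 tau0) _.
    rewrite -EFinD (_ : dotc (x p.1) phi - dotc (x p.2) phi = dotc w phi) //.
    by rewrite /dotc /=; ring.
  rewrite avgD //; [|exact: measurable_circle|exact/measurable_EFinP].
  by rewrite avg_circle_cst EFinD leeD2r //; exact: (@avg_strip _ w).
have q0 : 0 <= Num.min 1 (dist1 p) by rewrite le_min ler01 dist1_ge0.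
apply: (@le_trans _ _ ((Num.min 1 (dist1 p))%:E * (64 / cos 1 * tau / dist1 p + 2 / (n%:R * tau))%:E)%E).
  by rewrite lee_wpmul2l // lee_fin.
rewrite -EFinM lee_fin mulrDr; apply: lerD; last by rewrite ler_piMl // ge_min lexx.
rewrite mulrCA; apply: ler_piMr => //.
by rewrite ler_pdivrMr // mul1r ge_min lexx orbT.
Qed.

Lemma sum_expect_dist tau : (0 < n)%N -> 0 < tau ->
  (\sum_v `|expect n (fun phi l => (freq1 v phi l)%:E) - expect n (mean2 v)| <=
   (2 * (m%:R ^+ 2 * (64 / cos 1 * tau + 2 / (n%:R * tau))))%:E)%E.
Proof.
move=> n0 tau0.
have aC p : admissible n (fun phi l => (collide p phi l)%:R%:E).
  apply: admissible_fin => //; apply: jmeas_natr; apply: jmeas_same; exact: measurable_dotc.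
have q0 p : 0 <= 2 * Num.min 1 (dist1 p) by rewrite mulr_ge0 // le_min ler01 dist1_ge0.
have a1 : admissible n (fun _ _ => 1%:E) by split => //; exact: jmeas_cst.
apply: (@le_trans _ _ (\sum_v expect n (gap v))%E).
  apply: lee_sum => v _; apply: expect_dist.
  - exact: admissible_freq1.
  - exact: admissible_mean2.
  - exact: admissible_gap.
  - apply: (@le_lt_trans _ _ 1%:E); last exact: ltry.
    rewrite -(expect_cst n 1); apply: le_expect => //; first exact: admissible_freq1.
    by move=> *; rewrite lee_fin freq_le1.
  - apply: (@le_lt_trans _ _ 1%:E); last exact: ltry.
    rewrite -(expect_cst n 1); apply: le_expect => //; first exact: admissible_mean2.
    move=> phi l [sl _]; rewrite -(avg_box_cst 1); apply: le_avg => //.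
    + by move=> z _; rewrite lee_fin freq_ge0.
    + by apply/measurable_EFinP; exact: measurable_freq2_z.
    + by move=> z _; rewrite lee_fin freq_le1.
  - by move=> phi l [sl _]; exact: freq1_le_mean2.
  - by move=> phi l [sl _]; exact: mean2_le_freq1.
rewrite -expect_sum; last by move=> v; exact: admissible_gap.
apply: (@le_trans _ _ (expect n (fun phi l => \sum_(p : 'I_m * 'I_m)
   (2 * Num.min 1 (dist1 p))%:E * (collide p phi l)%:R%:E)%E)).
  apply: le_expect; last exact: sum_gap_le.
  - by apply: admissible_sum => v; exact: admissible_gap.
  - by apply: admissible_sum => p; exact: admissibleZ.
rewrite expect_sum; last by move=> p; exact: admissibleZ.
apply: (@le_trans _ _ (\sum_(p : 'I_m * 'I_m) (2 * (64 / cos 1 * tau + 2 / (n%:R * tau)))%:E)%E).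
  apply: lee_sum => p _; rewrite expectZ // EFinM -muleA [leRHS]EFinM.
  by apply: lee_wpmul2l; [rewrite lee_fin|exact: expect_collide].
rewrite sumEFin lee_fin sumr_const card_prod card_ord -[leLHS]mulr_natl natrM.
by rewrite le_eqVlt; apply/orP; left; apply/eqP; ring.
Qed.

End Main.

(** * The two distributions *)

Section Bridge.
Variables (n m : nat) (x : 'I_m -> pt) (v : {ffun 'I_m -> bool}).
Local Notation RR := (R : realType).

Lemma bitv_eq b c : (bitv b == bitv c) = (b == c).
Proof.
have N11 : (1 == -1 :> R) = false by apply/eqP; lra.
by case: b; case: c; rewrite /bitv ?eqxx // eq_sym.
Qed.

Lemma mul_sign (K : nzRingType) (b c : bool) :
  (if b then 1 else -1) * (if c then 1 else -1) = if b (+) ~~ c then 1 else -1 :> K.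
Proof. by case: b; case: c; rewrite /= ?mulr1 ?mul1r ?mulrNN ?mulr1. Qed.

Lemma bitv_sgn b t : bitv b * sgn t = bitv (b (+) ~~ (0 <= t)).
Proof. exact: mul_sign. Qed.

Lemma dot_perp p phi :
  dot p (theta_perp (theta_of phi)) = dotc (R := RR) (perp (R := RR) p) phi.
Proof.
have E (K : comNzRingType) (a b c d : K) : a * d + b * - c = - b * c + a * d by ring.
exact: (E RR).
Qed.

Lemma fD1_outcome phi (a : seq R) (b : {ffun 'I_n.+1 -> bool}) i : inbox (R := RR) n a ->
  fD1 (theta_of phi) a b (x i) =
  bitv (outcome b (pieces (R := RR) x phi a i) true).
Proof.
move=> [sa Ha]; rewrite /fD1 pieceE // /pieces.
rewrite -/(dotc (R := RR) (x i) phi).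
by case: (piece_index _ _) => //= k; rewrite addbF.
Qed.

Lemma gD2_outcome phi (a : seq R) (b : {ffun 'I_n.+1 -> bool}) z i : inbox (R := RR) n a ->
  gD2 (theta_of phi) a b z (x i) =
  bitv (outcome b (pieces (R := RR) x phi a i) (side (R := RR) x phi z i)).
Proof.
move=> [sa Ha]; rewrite /gD2 pieceE // /pieces.
rewrite -/(dotc (R := RR) (x i) phi).
case: (piece_index _ _) => [//|k].
by rewrite dot_perp; exact: bitv_sgn.
Qed.

(** Both sides unfold to the same iterated averages, so it suffices to compare integrands on the
    box, where [pieceE] applies. *)
Lemma probD1E : probD1 n.+1 x v = expect (R := RR) n (fun phi l => (freq1 (R := RR) n x v phi l)%:E).
Proof.
apply: (@eq_avg RR) => phi _; apply: (@eq_avgn RR) => l Hl.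
rewrite /unif_bits /freq1 /freq natr_sum EFinM -sumEFin; congr (_ * _)%E.
apply: eq_bigr => b _; rewrite /indic /hits.
rewrite (eq_forallb (P2 := fun i => outcome b (pieces (R := RR) x phi l i) true == v i)); last first.
  by move=> i; rewrite (fD1_outcome _ _ _ Hl) bitv_eq.
by case: [forall i, _].
Qed.

Lemma probD2E : probD2 n.+1 x v = expect (R := RR) n (mean2 (R := RR) n x v).
Proof.
apply: (@eq_avg RR) => phi _; apply: (@eq_avgn RR) => l Hl.
rewrite mean2E; last by case: Hl.
congr (_ * _)%E; apply: eq_bigr => b _.
apply: (@eq_avg RR) => z _; rewrite /indic /hits.
rewrite (eq_forallb (P2 := fun i =>
  outcome b (pieces (R := RR) x phi l i) (side (R := RR) x phi z i) == v i)); last first.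
  by move=> i; rewrite (gD2_outcome _ _ _ _ Hl) bitv_eq.
by case: [forall i, _].
Qed.

End Bridge.

(** * Choice of the threshold and of the constant *)

Theorem theorem5p2 :
  exists C : R, forall (s : nat), (2 <= s)%N ->
    forall (m : nat) (x : 'I_m -> pt),
      ((m%:R : R) <= (s%:R : R) `^ (10^-1)) ->
      (tv_D1_D2 s x <= (C * (s%:R : R) `^ (- 10^-1))%:E)%E.
Proof.
(* The term [64 / cos 1] comes from the strip estimate, and 4 from the bound [K] on the avoidance
   term. With [s = n + 2] there are [n + 1] sampled breakpoints. *)
exists (64 / cos 1 + 4) => -[//|[//|n]] _ m x hm.
set s := n.+2 in hm *.
have s1 : 1 <= s%:R :> R by rewrite ler1n.
have c0 := cos1_gt0 (R : realType).
have A0 : 0 <= 64 / cos 1 :> R by apply: divr_ge0 => //; exact: ltW.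
(* This choice balances [tau] against [1 / (s * tau)]. *)
pose tau : R := s%:R `^ (- 2^-1).
have tau0 : 0 < tau by apply: powR_gt0; lra.
have tau0' := ltW tau0.
have st : s%:R * tau = tau^-1.
  rewrite /tau -powRN opprK -{1}(powRr1 (ltW (lt_le_trans ltr01 s1))) -powRD.
    by congr powR; lra.
  by apply/implyP => _; lra.
(* This follows from [s * tau ^ 2 = 1] and [s <= 2 * (s - 1)]. *)
have K : 2 / (n.+1%:R * tau) <= 4 * tau.
  rewrite ler_pdivrMr ?mulr_gt0 ?ltr0n //.
  have : tau * (s%:R * tau) = 1 by rewrite st divff // gt_eqF.
  rewrite /s -[n.+2%:R]natr1 => H.
  have n1 : 1 <= n.+1%:R :> R by rewrite ler1n.
  have : 0 <= (n.+1%:R - 1) * (tau * tau) by rewrite mulr_ge0 ?mulr_ge0 ?subr_ge0 // ltW.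
  by lra.
have B := sum_expect_dist (R := (R : realType)) x (ltn0Sn n) tau0.
rewrite /tv_D1_D2; under eq_bigr do rewrite probD1E probD2E.
apply: (@le_trans _ _ ((2^-1)%:E * (2 * (m%:R ^+ 2 * (64 / cos 1 * tau + 2 / (n.+1%:R * tau))))%:E)%E).
  by rewrite lee_wpmul2l // lee_fin.
(* The factor 1/2 of the total variation distance cancels the 2 from [sum_diff_hits]. *)
rewrite -EFinM lee_fin mulKf //.
apply: (@le_trans _ _ ((s%:R `^ (10^-1)) ^+ 2 * ((64 / cos 1 + 4) * tau))).
  apply: ler_pM => //.
  - by apply: addr_ge0; [exact: mulr_ge0|apply: divr_ge0 => //; exact: mulr_ge0].
  - by apply: lerXn2r => //; rewrite nnegrE ?powR_ge0.
  - by rewrite [leRHS]mulrDl lerD2l.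
rewrite mulrCA ler_wpM2l ?addr_ge0 //.
(* The exponents add up to [2 / 10 - 1 / 2 = - 3 / 10], below [- 1 / 10], and the base is at least
   1. *)
rewrite -powR_mulrn ?powR_ge0 // -powRrM /tau -powRD; last by apply/implyP => _; lra.
by apply: ler_powR => //; lra.
Qed.
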